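(* Let $K\ge 1$, let $M_1,\dots,M_K,N_1,\dots,N_K$ be positive integers, and let $d$ be an integer with $1\le d\le\min\{M_k,N_k\}$ for all $k$. Suppose that $M_k$ and $N_k$ are divisible by $d$ for all $k$. Then the tuple $(d_1,\dots,d_K)=(d,\dots,d)$ is achievable through linear interference alignment for generic channel matrices if and only if $$|\mathcal{I}|\,d\ \le\ \sum_{k:\,(k,j)\in\mathcal{I}}(M_k-d)+\sum_{j:\,(k,j)\in\mathcal{I}}(N_j-d)\qquad\text{for all }\mathcal{I}\subseteq\mathcal{J},$$ where $\mathcal{J}=\{(k,j)\mid 1\le k\neq j\le K\}$.
   Context: Setting: a $K$-user flat fading MIMO interference channel in which transmitter $k$ has $M_k$ antennas and receiver $k$ has $N_k$ antennas. The channel from transmitter $j$ to receiver $k$ is a complex matrix $\mathbf{H}_{kj}$ of size $N_k\times M_j$. Achievability through linear interference alignment: for given channel matrices $(\mathbf{H}_{kj})_{k,j=1}^K$, a tuple $(d_1,\dots,d_K)$ of nonnegative integers is achievable through linear interference alignment (without channel extension) if there exist matrices $\mathbf{V}_k\in\mathbb{C}^{M_k\times d_k}$ and $\mathbf{U}_k\in\mathbb{C}^{N_k\times d_k}$, $k=1,\dots,K$, such that $$\mathbf{U}_k^H\mathbf{H}_{kj}\mathbf{V}_j=\mathbf{0}\ \text{ for all } j\neq k,\qquad \operatorname{rank}(\mathbf{U}_k^H\mathbf{H}_{kk}\mathbf{V}_k)=d_k\ \text{ for all } k,$$ where $(\cdot)^H$ is the conjugate transpose. Generic: a property holds for generic channel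 matrices if it holds for all $(\mathbf{H}_{kj})_{k,j}$ in some nonempty Zariski open subset of $\prod_{k,j=1}^K\mathbb{C}^{N_k\times M_j}$. Summation convention: $\sum_{k:(k,j)\in\mathcal{I}}$ is the sum over the set of all $k$ such that $(k,j)\in\mathcal{I}$ for some $j$ (each such $k$ counted once); $\sum_{j:(k,j)\in\mathcal{I}}$ is the sum over the set of all $j$ such that $(k,j)\in\mathcal{I}$ for some $k$ (each such $j$ counted once). *)

(* Defs.v *)
From HB Require Import structures.
From mathcomp Require Export all_boot all_order all_algebra.
From mathcomp Require Export spectral reals complex mpoly.

Set Implicit Arguments.
Unset Strict Implicit.
Unset Printing Implicit Defensive.

Local Open Scope ring_scope.
Local Open Scope sesquilinear_scope.

(* C is intended to be R[i] for R : realType; [^t*] is then the usual conjugate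
   transpose. *)
Section Channels.
Variables (C : numClosedFieldType) (K : nat) (M N : 'I_K -> nat).

(* [H k j] is the channel from transmitter [j] to receiver [k]. *)
Definition channels := forall k j : 'I_K, 'M[C]_(N k, M j).

Definition achievable (H : channels) (d : 'I_K -> nat) : Prop :=
  exists (V : forall k, 'M[C]_(M k, d k)) (U : forall k, 'M[C]_(N k, d k)),
    (forall k j, j != k -> (U k)^t* *m H k j *m V j = 0) /\
    (forall k, \rank ((U k)^t* *m H k k *m V k) = d k).

(* The coordinates of the affine space of channels: the pair (k, j) tags the
   (row, column) position of an entry of [H k j]. *)
Definition coord : finType :=
  {kj : 'I_K * 'I_K & ('I_(N kj.1) * 'I_(M kj.2))%type}.

Definition entry (H : channels) (x : coord) : C :=
  H (tag x).1 (tag x).2 (tagged x).1 (tagged x).2.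

Definition eval_channels (p : {mpoly C[#|coord|]}) (H : channels) : C :=
  p.@[fun i => entry H (enum_val i)].

Definition zariski_closed (Z : channels -> Prop) : Prop :=
  exists S : {mpoly C[#|coord|]} -> Prop,
    forall H, Z H <-> (forall p, S p -> eval_channels p H = 0).

Definition zariski_open (U : channels -> Prop) : Prop :=
  zariski_closed (fun H => ~ U H).

Definition generically (P : channels -> Prop) : Prop :=
  exists U : channels -> Prop,
    [/\ zariski_open U, exists H, U H & forall H, U H -> P H].

End Channels.

(* Main.v *)
(* Necessity. Normalize U_j and V_k to the identity on chosen pivot rows. The equations
   U_j^T H_jk V_k = 0, (k, j) in I, then express the |I| d^2 pivotal entries of H as
   polynomials in the other entries of H and in the free entries of U and V. If the
   inequality fails for I there are fewer parameters than entries, so the channels that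
   satisfy these equations lie on a hypersurface; there are finitely many choices of
   pivots.

   Sufficiency. By quantifier elimination, achievability is generically true or
   generically false, so it is enough to find achievable channels off any given
   hypersurface h = 0. Hall's theorem turns the inequalities into an assignment of every
   equation (k, j) to one of the M_k/d - 1 free d x d blocks of V_k or N_j/d - 1 free
   blocks of U_j, and thereby gives channels H_0 at which the equations, linearized at
   the pivot solution, are solvable for every right-hand side. Hence from H_0 there start
   curves of achievable channels in every direction, and in a suitable direction h does
   not vanish identically along such a curve. *)
Require Import Defs.
From mathcomp Require Import closed_field boolp zify ring.

Set Implicit Arguments.
Unset Strict Implicit.
Unset Printing Implicit Defensive.
Import Order.TTheory GRing.Theory Num.Theory.
Local Open Scope ring_scope.
Local Open Scope sesquilinear_scope.

(** * Nonvanishing of polynomials *)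

Lemma poly_nonroot (F : numDomainType) (p : {poly F}) :
  p != 0 -> exists x, p.[x] != 0.
Proof.
(* In characteristic 0 these [size p] candidates are distinct, one more than the degree of [p]
   allows as roots. *)
move=> p0; pose rs := [seq i%:R : F | i <- iota 0 (size p)].
have /allPn[x _ px] : ~~ all (root p) rs.
  have rs_uniq : uniq rs by rewrite map_inj_uniq ?iota_uniq //; apply: mulrIn; rewrite oner_eq0.
  by apply/negP => /(max_poly_roots p0)/(_ rs_uniq); rewrite size_map size_iota ltnn.
by exists x.
Qed.

Lemma digits_inj B n (f g : nat -> nat) :
    (forall i, (i < n)%N -> (f i < B)%N) -> (forall i, (i < n)%N -> (g i < B)%N) ->
    (\sum_(i < n) f i * B ^ i = \sum_(i < n) g i * B ^ i)%N ->
  forall i, (i < n)%N -> f i = g i.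
Proof.
elim: n f g => [//|n IHn] f g fB gB.
have split_digit (h : nat -> nat) : (\sum_(i < n.+1) h i * B ^ i =
    (\sum_(i < n) h i.+1 * B ^ i) * B + h 0)%N.
  rewrite big_ord_recl expn0 muln1 addnC big_distrl; congr (_ + _)%N.
  by apply: eq_bigr => i _; rewrite /= expnSr mulnA.
rewrite !split_digit => eq_sum.
have eq0 : f 0%N = g 0%N.
  by move/(congr1 (modn^~ B)): eq_sum; rewrite !modnMDl !modn_small ?fB ?gB.
have B0 : (0 < B)%N by apply: leq_ltn_trans (fB 0%N _).
move: eq_sum; rewrite eq0 => /addIn/eqP; rewrite eqn_pmul2r // => /eqP eqS.
by case=> [|i] lt_in //; apply: (IHn (f \o S) (g \o S)) => // j; [exact: (fB j.+1)|exact: (gB j.+1)].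
Qed.

Lemma horner_mmap (F : comNzRingType) n (p : {mpoly F[n]}) (w : 'I_n -> {poly F}) x :
  (mmap (@polyC F) w p).[x] = p.@[fun i => (w i).[x]].
Proof.
rewrite mevalE /mmap horner_sum; apply: eq_bigr => m _.
rewrite hornerM hornerC /mmap1 horner_prod; congr (_ * _).
by apply: eq_bigr => i _; rewrite horner_exp.
Qed.

(* Kronecker substitution ['X_i := 'X^(B ^ i)] with [B] above all exponents keeps the
   monomials of [p] apart. *)
Lemma mpoly_nonroot (F : numDomainType) n (p : {mpoly F[n]}) :
  p != 0 -> exists v, p.@[v] != 0.
Proof.
move=> p0; pose B := (msize p).+1; pose code (m : 'X_{1..n}) := (\sum_(i < n) m i * B ^ i)%N.
pose w i : {poly F} := 'X^(B ^ val (i : 'I_n)).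
have mmap1E m : mmap1 w m = 'X^(code m).
  rewrite /mmap1 /w /code.
  rewrite (big_morph (fun k : nat => 'X^k : {poly F}) (exprD _) (expr0 _)).
  by apply: eq_bigr => i _; rewrite -exprM mulnC.
have code_inj m m' : m \in msupp p -> m' \in msupp p -> code m = code m' -> m = m'.
  pose digit (k : 'X_{1..n}) (i : nat) : nat := oapp k 0%N (insub i : option 'I_n).
  have digitE k (i : 'I_n) : digit k i = k i by rewrite /digit valK.
  have digit_lt k i : k \in msupp p -> (digit k i < B)%N.
    move=> /msize_mdeg_lt kp; rewrite /digit; case: insub => //= j.
    apply: leq_ltn_trans (leqW kp).
    by rewrite mdegE (bigD1 j) //= leq_addr.
  move=> mp m'p eq_code; apply/mnmP => i; rewrite -!digitE.
  apply: (@digits_inj B n) => // [j _|j _|]; rewrite ?digit_lt //.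
  by under eq_bigr do rewrite digitE; under [RHS]eq_bigr do rewrite digitE.
suff /poly_nonroot[x] : mmap (@polyC F) w p != 0 by rewrite horner_mmap; eexists; eassumption.
have mp := mlead_supp p0.
apply: contraNneq (p0) => /(congr1 (fun q : {poly F} => q`_(code (mlead p)))).
rewrite coef0 /mmap coef_sum (bigD1_seq (mlead p)) ?msupp_uniq //=.
rewrite mmap1E coefCM coefXn eqxx mulr1 big_seq_cond big1 ?addr0 => [/eqP|m /andP[mp' ne]].
  by rewrite mleadc_eq0.
rewrite mmap1E coefCM coefXn; case: eqP => [/esym/code_inj eqm|]; last by rewrite mulr0.
by rewrite eqm ?eqxx // in ne.
Qed.

Lemma mmap_comp_mpoly (F S : comNzRingType) (f : {rmorphism F -> S}) n k
    (u : 'I_k -> S) (p : {mpoly F[n]}) (q : n.-tuple {mpoly F[k]}) :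
  mmap f u (p \mPo q) = mmap f (fun i => mmap f u (tnth q i)) p.
Proof.
rewrite comp_mpolyE raddf_sum; apply: eq_bigr => m _ /=.
rewrite mmapZ rmorph_prod; congr (_ * _).
by apply: eq_bigr => i _; rewrite rmorphXn.
Qed.

(* Expand [h] at [y] and take for [z] a nonroot of the homogeneous part of lowest
   degree [r]: along a curve leaving [y] in the direction [z], [h] vanishes to order
   exactly [r]. *)
Lemma mpoly_curve_neq0 (F : numDomainType) n (h : {mpoly F[n]}) (y : 'I_n -> F) :
  h != 0 -> exists z : 'I_n -> F, forall w : 'I_n -> {poly F},
    (forall i, (w i).[0] = z i) -> mmap (@polyC F) (fun i => (y i)%:P + 'X * w i) h != 0.
Proof.
move=> h0; pose t := [tuple ('X_i + (y i)%:MP : {mpoly F[n]}) | i < n]; pose g := h \mPo t.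
have g0 : g != 0.
  have [v] := mpoly_nonroot h0; apply: contraNneq => g0.
  have := congr1 (meval (fun i => v i - y i)) g0.
  rewrite meval0 comp_mpoly_meval => <-; apply/eqP/meval_eq => i.
  by rewrite tnth_mktuple mevalD mevalXU mevalC subrK.
have [r rP rmin] : exists2 r, has (fun m => mdeg m == r) (msupp g) &
    forall m, m \in msupp g -> (r <= mdeg m)%N.
  have ex : exists r, has (fun m => mdeg m == r) (msupp g).
    by exists (mdeg (mlead g)); apply/hasP; exists (mlead g) => //; apply: mlead_supp.
  case: (ex_minnP ex) => r rP rmin; exists r => // m mg.
  by apply: rmin; apply/hasP; exists m.
pose gr := \sum_(m <- msupp g | mdeg m == r) g@_m *: 'X_[m].
have /mpoly_nonroot[z gz] : gr != 0.
  case/hasP: rP => m mg /eqP degm; apply: contraTneq mg => gr0.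
  rewrite mcoeff_msupp negbK; apply/eqP; have := congr1 (mcoeff m) gr0.
  rewrite mcoeff0 /gr raddf_sum /=; have [mg|/memN_msupp_eq0 -> //] := boolP (m \in msupp g).
  rewrite -big_filter (bigD1_seq m) ?filter_uniq ?msupp_uniq ?mem_filter ?degm ?eqxx //=.
  rewrite mcoeffZ mcoeffX eqxx mulr1 big1 ?addr0 // => m' ne.
  by rewrite mcoeffZ mcoeffX (negbTE ne) mulr0.
exists z => w wz.
(* Substituting ['X * w] into a monomial of degree [e] produces a factor ['X^e]; once ['X^r] is
   factored out, only the part [gr] survives at 0. *)
pose G := \sum_(m <- msupp g) (g@_m)%:P * ('X^(mdeg m - r) * mmap1 w m).
have -> : mmap (@polyC F) (fun i => (y i)%:P + 'X * w i) h = 'X^r * G.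
  transitivity (mmap (@polyC F) (fun i => 'X * w i) g).
    rewrite mmap_comp_mpoly; apply: eq_bigr => m _; congr (_ * _).
    by apply: mmap1_eq => i; rewrite tnth_mktuple mmapD mmapX mmap1U mmapC addrC.
  rewrite mulr_sumr /mmap [LHS]big_seq [RHS]big_seq; apply: eq_bigr => m /rmin rm.
  rewrite mulrCA; congr (_ * _); rewrite mulrA -exprD subnKC // /mmap1 mdegE.
  rewrite (big_morph (fun k : nat => 'X^k : {poly F}) (exprD _) (expr0 _)) -big_split.
  by apply: eq_bigr => i _; rewrite exprMn.
rewrite mulf_neq0 ?expf_neq0 ?polyX_eq0 //.
apply: contraNneq gz => /(congr1 (fun q => q.[0])); rewrite horner0 => <-.
rewrite /G /gr horner_sum raddf_sum /= big_mkcond [X in _ == X]big_seq [X in X == _]big_seq; apply/eqP.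
apply: eq_bigr => m /rmin rm; rewrite hornerM hornerC hornerM hornerXn.
have -> : (mmap1 w m).[0] = \prod_(i < n) z i ^+ m i.
  by rewrite horner_prod; apply: eq_bigr => i _; rewrite horner_exp wz.
have [->|ne] := eqVneq; first by rewrite subnn expr0 mul1r mevalZ mevalX.
by rewrite expr0n subn_eq0 leqNgt ltn_neqAle eq_sym ne rm mul0r mulr0.
Qed.

(** * Algebraic dependence *)

Lemma msize_prod_le (F : idomainType) n D I (r : seq I) (f : I -> {mpoly F[n]}) (a : I -> nat) :
    (forall k, (msize (f k) <= D.+1)%N) ->
  (msize (\prod_(k <- r) f k ^+ a k) <= (\sum_(k <- r) a k * D).+1)%N.
Proof.
have msizeM_leS (p q : {mpoly F[n]}) x y :
    (msize p <= x.+1)%N -> (msize q <= y.+1)%N -> (msize (p * q) <= (x + y).+1)%N.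
  have [->|p0] := eqVneq p 0; first by rewrite mul0r msize0.
  have [->|q0] := eqVneq q 0; first by rewrite mulr0 msize0.
  by move=> px qy; rewrite msizeM //; lia.
move=> fD; elim/big_rec2: _ => [|k s q _ IH]; first by rewrite msize1.
apply: (msizeM_leS) => //; elim: (a k) => [|b IHb]; first by rewrite expr0 msize1.
by rewrite exprS mulSn; apply: (msizeM_leS).
Qed.

(* The [T ^ m] products of powers below [T] of the [f i] lie in the space of polynomials
   with exponents below [S = (D m + 1) T], of dimension [S ^ n < T ^ m]. *)
Lemma mpoly_alg_dep (F : fieldType) m n (f : m.-tuple {mpoly F[n]}) :
  (n < m)%N -> exists2 q : {mpoly F[m]}, q != 0 & q \mPo f = 0.
Proof.
move=> lt_nm; pose D := (\max_(k < m) msize (tnth f k))%N.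
have fD k : (msize (tnth f k) <= D.+1)%N by apply/leqW/(leq_bigmax k).
(* This [T] exceeds [(D * m).+1 ^ n], so [S ^ n = (D * m).+1 ^ n * T ^ n < T ^ n.+1 <= T ^ m]. *)
pose T := ((D * m).+1 ^ n).+1; pose S := ((D * m).+1 * T)%N.
pose mon k B (i : {ffun 'I_k -> 'I_B}) := [multinom (i l : nat) | l < k].
pose g (i : {ffun 'I_m -> 'I_T}) : {mpoly F[n]} := 'X_[mon _ _ i] \mPo f.
pose A := \matrix_(i < #|{ffun 'I_m -> 'I_T}|, j < #|{ffun 'I_n -> 'I_S}|)
   (g (enum_val i))@_(mon _ _ (enum_val j)).
have /rowV0Pn[v /sub_kermxP vA v0] : kermx A != 0.
  rewrite kermx_eq0 /row_free neq_ltn; apply/orP; left.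
  apply: leq_ltn_trans (rank_leq_col _) _; rewrite !card_ffun !card_ord.
  apply: (@leq_trans (T ^ n.+1)); last by rewrite leq_pexp2l.
  by rewrite expnMn expnS ltn_pmul2r ?expn_gt0.
have mon_inj k B : injective (mon k B).
  by move=> i i' /mnmP eq_ii'; apply/ffunP => l; have := eq_ii' l; rewrite !mnmE => /val_inj.
exists (\sum_i v 0 (enum_rank i) *: 'X_[mon m T i]).
  apply: contraNneq v0 => q0; apply/eqP/rowP => i; rewrite mxE.
  have := congr1 (mcoeff (mon _ _ (enum_val i))) q0; rewrite mcoeff0 raddf_sum /=.
  rewrite (bigD1 (enum_val i)) //= mcoeffZ mcoeffX eqxx mulr1 enum_valK big1 ?addr0 //.
  by move=> i' ne; rewrite mcoeffZ mcoeffX (inj_eq (@mon_inj _ _)) (negbTE ne) mulr0.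
have small i (l : 'X_{1..n}) : l \in msupp (g i) -> (mdeg l < S)%N.
  move=> /msize_mdeg_lt lg; apply: leq_trans lg _; rewrite /g comp_mpolyX.
  apply: leq_trans (msize_prod_le _ _ fD) _.
  have : (\sum_(k < m) mon m T i k * D <= \sum_(k < m) T * D)%N.
    by apply: leq_sum => k _; rewrite mnmE leq_mul2r ltnW ?orbT.
  have arith a b t x : (x <= b * (t.+1 * a))%N -> (x < (a * b).+1 * t.+1)%N by nia.
  by rewrite sum_nat_const card_ord; apply: arith.
rewrite raddf_sum; apply/mpolyP => l; rewrite mcoeff0 raddf_sum /=.
under eq_bigr do rewrite comp_mpolyZ mcoeffZ.
(* Monomials of degree at least [S] occur in no product; the others have exponents below [S] and
   label columns of [A], where the relation [v] applies. *)
have [lS|lS] := ltnP (mdeg l) S; last first.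
  by apply: big1 => i _; rewrite memN_msupp_eq0 ?mulr0 //; apply: contraL lS => /small; rewrite ltnNge.
have lS' k : (l k < S)%N by apply: leq_ltn_trans lS; rewrite mdegE (bigD1 k) //= leq_addr.
pose j : {ffun 'I_n -> 'I_S} := [ffun k => Ordinal (lS' k)].
have -> : l = mon _ _ j by apply/mnmP => k; rewrite mnmE ffunE.
have := congr1 (fun B : 'rV_ _ => B 0 (enum_rank j)) vA; rewrite !mxE => vAj; rewrite -[RHS]vAj.
rewrite (reindex (@enum_val {ffun 'I_m -> 'I_T} predT)) /=; last exact/onW_bij/enum_val_bij.
by apply: eq_bigr => i _; rewrite mxE !enum_rankK enum_valK.
Qed.

(** * Generic solvability of polynomial systems *)

Definition cat_env (T : Type) n m (y : 'I_n -> T) (x : 'I_m -> T) (k : 'I_(n + m)) : T :=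
  match split k with inl a => y a | inr b => x b end.

(** Binding variable [n] over an environment of length [n] appends a value, so the quantifiers
    supply the new entries one after another. *)
Lemma holds_exists_iota (F : unitRingType) (f : GRing.formula F) n m (e : seq F) :
  size e = n ->
  GRing.holds e (foldr GRing.Exists f (iota n m)) <->
  exists2 x : seq F, size x = m & GRing.holds (e ++ x) f.
Proof.
elim: m n e => [|m IHm] n e szE /=.
  by split=> [ef|[x /size0nil ->]]; [exists [::]; rewrite ?cats0 | rewrite cats0].
have set_rcons x0 : set_nth 0 e n x0 = rcons e x0 by rewrite -szE set_nthE ltnn subnn cats1.
split=> [[x0]|[[//|x0 x] [szx ef]]].
  rewrite set_rcons => /IHm[|x szx ef]; first by rewrite size_rcons szE.
  by exists (x0 :: x); rewrite /= ?szx // -cat_rcons.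
exists x0; rewrite set_rcons; apply/IHm; first by rewrite size_rcons szE.
by exists x; rewrite // cat_rcons.
Qed.

Lemma mpoly_term (F : comUnitRingType) n (p : {mpoly F[n]}) :
  exists2 t, GRing.rterm t & forall e, GRing.eval e t = p.@[fun i => e`_i].
Proof.
elim/mpolyind: p => [|c m p _ _ [t rt tE]].
  by exists 0%T => // e; rewrite meval0.
pose prodt : GRing.term F := foldr (fun (i : 'I_n) t => GRing.Mul (GRing.Exp ('X_i) (m i)) t) 1%T (index_enum 'I_n).
have rprod : GRing.rterm prodt by rewrite /prodt; elim: index_enum.
exists (GRing.Add (GRing.Mul (c%:T) prodt) t); first by rewrite /= rprod rt.
move=> e /=; rewrite tE mevalD mevalZ mevalX; congr (_ * _ + _).
by rewrite /prodt unlock; elim: index_enum => //= i r ->.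
Qed.

Lemma nth_codom_ord (T : Type) (x0 : T) n (y : 'I_n -> T) (i : 'I_n) : nth x0 (codom y) i = y i.
Proof. by rewrite (nth_map i) ?size_enum_ord // nth_ord_enum. Qed.

Lemma rterm_mpoly (F : comUnitRingType) n (t : GRing.term F) : GRing.rterm t ->
  exists p : {mpoly F[n]}, forall y, GRing.eval (codom y) t = p.@[y].
Proof.
elim: t => //=.
- move=> i _; have [lt_in|le_ni] := ltnP i n.
    by exists 'X_(Ordinal lt_in) => y; rewrite mevalXU -(nth_codom_ord 0 y).
  (* A variable beyond the environment evaluates to the default value 0. *)
  by exists 0 => y; rewrite meval0 nth_default // size_codom card_ord.
- by move=> c _; exists c%:MP => y; rewrite mevalC.
- by move=> k _; exists k%:R => y; rewrite rmorph_nat.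
- by move=> t1 IH1 t2 IH2 /andP[/IH1[p pE] /IH2[q qE]]; exists (p + q) => y; rewrite mevalD pE qE.
- by move=> t IH /IH[p pE]; exists (- p) => y; rewrite mevalN pE.
- by move=> t IH k /IH[p pE]; exists (p *+ k) => y; rewrite mevalMn pE.
- by move=> t1 IH1 t2 IH2 /andP[/IH1[p pE] /IH2[q qE]]; exists (p * q) => y; rewrite mevalM pE qE.
- by move=> t IH k /IH[p pE]; exists (p ^+ k) => y; rewrite rmorphXn pE.
Qed.

(** An equation between distinct polynomials fails off the zeros of their difference; one between
    equal polynomials always holds. A connective combines the two constant truth values off the
    union of both hypersurfaces. *)
Lemma qf_generic (F : fieldType) n (f : GRing.formula F) :
    GRing.qf_form f -> GRing.rformula f ->
  exists2 h : {mpoly F[n]}, h != 0 &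
    exists b, forall y, h.@[y] != 0 -> GRing.qf_eval (codom y) f = b.
Proof.
have binop (op : bool -> bool -> bool) (f1 f2 f12 : GRing.formula F) :
    (forall y, GRing.qf_eval y f12 = op (GRing.qf_eval y f1) (GRing.qf_eval y f2)) ->
    (exists2 h : {mpoly F[n]}, h != 0 & exists b, forall y, h.@[y] != 0 -> GRing.qf_eval (codom y) f1 = b) ->
    (exists2 h : {mpoly F[n]}, h != 0 & exists b, forall y, h.@[y] != 0 -> GRing.qf_eval (codom y) f2 = b) ->
    exists2 h : {mpoly F[n]}, h != 0 & exists b, forall y, h.@[y] != 0 -> GRing.qf_eval (codom y) f12 = b.
  move=> f12E [h h0 [b hb]] [k k0 [c kc]]; exists (h * k); first by rewrite mulf_neq0.
  exists (op b c) => y; rewrite mevalM mulf_eq0 negb_or => /andP[hy ky].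
  by rewrite f12E hb ?kc.
elim: f => //=.
- by move=> b _ _; exists 1; [rewrite oner_neq0 | exists b].
- move=> t1 t2 _ /andP[/(@rterm_mpoly _ n)[p pE] /(@rterm_mpoly _ n)[q qE]].
  have [eq_pq|ne_pq] := eqVneq p q.
    by exists 1; [rewrite oner_neq0 | exists true => y _; rewrite pE qE eq_pq eqxx].
  exists (p - q); first by rewrite subr_eq0.
  by exists false => y; rewrite mevalB subr_eq0 pE qE => /negbTE.
- by move=> f1 IH1 f2 IH2 /andP[q1 q2] /andP[r1 r2]; apply: (binop andb f1 f2 (GRing.And f1 f2)); auto.
- by move=> f1 IH1 f2 IH2 /andP[q1 q2] /andP[r1 r2]; apply: (binop orb f1 f2 (GRing.Or f1 f2)); auto.
- by move=> f1 IH1 f2 IH2 /andP[q1 q2] /andP[r1 r2]; apply: (binop implb f1 f2 (GRing.Implies f1 f2)); auto.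
- move=> f IH q r; case: (IH q r) => h h0 [b hb]; exists h => //.
  by exists (~~ b) => y /hb ->.
Qed.

(** Quantifier elimination over a closed field makes solvability in [x] a quantifier-free condition
    on [y], to which [qf_generic] applies. *)
Lemma solvable_generic (F : closedFieldType) n m (I : finType) (p : I -> {mpoly F[n + m]}) :
  let solvable y := exists x, forall i, (p i).@[cat_env y x] = 0 in
  exists2 h : {mpoly F[n]}, h != 0 &
    (forall y, h.@[y] != 0 -> solvable y) \/ (forall y, h.@[y] != 0 -> ~ solvable y).
Proof.
move=> solvable.
have [t /all_and2[rt tE]] := fin_all_exists (fun i =>
  let: ex_intro2 t rt tE := mpoly_term (p i) in ex_intro (fun t => GRing.rterm t /\ _) t (conj rt tE)).
pose f := foldr GRing.And (GRing.Bool true) [seq GRing.Equal (t i) 0%T | i <- enum I].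
have fP e : GRing.holds e f <-> forall i, GRing.eval e (t i) = 0.
  rewrite /f; split=> [ef i|ef].
    have : i \in enum I by rewrite mem_enum.
    by elim: (enum I) ef => //= j r IH [ej /IH er]; rewrite inE => /predU1P[->|/er].
  by elim: (enum I) => //=.
have rf : GRing.rformula (foldr GRing.Exists f (iota n m)).
  elim: (iota n m) => //=; rewrite /f; elim: (enum I) => //= i r ->; by rewrite rt.
have solP y : solvable y <-> GRing.holds (codom y) (foldr GRing.Exists f (iota n m)).
  rewrite holds_exists_iota; last by rewrite size_codom card_ord.
  have envE (x : 'I_m -> F) (k : 'I_(n + m)) : (codom y ++ codom x)`_k = cat_env y x k.
    rewrite nth_cat size_codom card_ord /cat_env; case: splitP => [a|b] ->.
      by rewrite nth_codom_ord.
    by rewrite addKn nth_codom_ord.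
  split=> [[x xP]|[x szx /fP ef]].
    exists (codom x); first by rewrite size_codom card_ord.
    by apply/fP => i; rewrite tE; apply: etrans (xP i); apply: meval_eq => k; apply: envE.
  exists (fun k => x`_k) => i; apply: etrans (ef i); rewrite tE; apply: meval_eq => k; rewrite -envE.
  congr (_ ++ _)`_k; apply: (@eq_from_nth _ 0); rewrite size_codom card_ord // => j jm.
  by rewrite (nth_codom_ord 0 (fun k : 'I_m => x`_k) (Ordinal jm)).
have wf := @ClosedFieldQE.wf_ex_elim F.
have ok := ClosedFieldQE.holds_ex_elim (@GRing.solve_monicpoly F).
have /andP[qfq rq] := GRing.quantifier_elim_wf wf rf.
have [h h0 [b hb]] := qf_generic n qfq rq; exists h => //.
case: b hb => hb; [left | right] => y /hb.
  by move/(GRing.quantifier_elim_rformP wf ok _ rf)/solP.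
by move/(GRing.quantifier_elim_rformP wf ok _ rf) => nsol /solP.
Qed.

(** * Hall's theorem *)

(** Induction on [#|D|]. If a nonempty proper subset [I] is tight, [I] is matched within its
    neighbours and [D :\: I] outside them. Otherwise nonempty proper subsets have a neighbour to
    spare, and any [i0] may take any element of [A i0]. *)
Lemma hall_marriage (T S : finType) (x0 : S) (A : T -> {set S}) (D : {set T}) :
    (forall I : {set T}, I \subset D -> (#|I| <= #|\bigcup_(i in I) A i|)%N) ->
  exists2 f : T -> S, {in D, forall i, f i \in A i} & {in D &, injective f}.
Proof.
have [n] := ubnP #|D|; elim: n A D => // n IHn A D ltDn hallD.
have [->|[i0 i0D]] := set_0Vmem D.
  by exists (fun=> x0) => [i|i j]; rewrite inE.
have bigcup_setD (B : {set S}) J : \bigcup_(i in J) (A i :\: B) = (\bigcup_(i in J) A i) :\: B.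
  apply/setP => x; rewrite inE; apply/bigcupP/andP => [[i iJ]|[nB /bigcupP[i iJ xA]]].
    by rewrite inE => /andP[nB xA]; split=> //; apply/bigcupP; exists i.
  by exists i; rewrite // inE nB.
have [/existsP[I /and3P[I0 ltID /eqP tight]]|slack] :=
    boolP [exists I : {set T}, [&& I != set0, I \proper D & #|I| == #|\bigcup_(i in I) A i|]].
  have sID := proper_sub ltID; pose B := \bigcup_(i in I) A i.
  have [||f fA f_inj] := IHn A I; first by apply: leq_trans (proper_card ltID) _.
    by move=> J sJ; apply: hallD; apply: subset_trans sJ sID.
  have [||g gA g_inj] := IHn (fun i => A i :\: B) (D :\: I).
  - have := cardsID I D; rewrite (setIidPr sID); move: I0; rewrite -card_gt0; lia.
  - move=> J; rewrite subsetD => /andP[sJD dJI]; rewrite bigcup_setD.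
    (* Hall's condition for [J :|: I], minus the [#|I|] neighbours of the tight set [I], is the
       condition for [J]. *)
    have /hallD : J :|: I \subset D by rewrite subUset sJD.
    rewrite bigcup_setU -/B cardsU (disjoint_setI0 dJI) cards0 subn0 tight -/B.
    have := cardsID B (\bigcup_(i in J :|: I) A i).
    rewrite bigcup_setU -/B setDUl setDv setU0.
    have -> : (\bigcup_(i in J) A i :|: B) :&: B = B by apply/setIidPr/subsetUr.
    by move=> <-; rewrite addnC leq_add2l.
  have fB i : i \in I -> f i \in B by move=> iI; apply/bigcupP; exists i => //; apply: fA.
  have gB i : i \in D -> i \notin I -> g i \notin B.
    by move=> iD iI; have := gA i; rewrite !inE iD iI => /(_ isT)/andP[].
  exists (fun i => if i \in I then f i else g i) => [i iD|i j iD jD].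
    case: ifPn => [/fA //|iI]; have := gA i; rewrite !inE iD iI => /(_ isT)/andP[] //.
  case: ifPn => iI; case: ifPn => jI eq_ij.
  - exact: f_inj eq_ij.
  - by have := gB j jD jI; rewrite -eq_ij fB.
  - by have := gB i iD iI; rewrite eq_ij fB.
  - by apply: g_inj eq_ij; rewrite inE ?iI ?jI.
have /card_gt0P[x xA] : (0 < #|A i0|)%N.
  have := hallD [set i0]; rewrite sub1set i0D cards1 => /(_ isT).
  by rewrite big_set1.
have [||f fA f_inj] := IHn (fun i => A i :\: [set x]) (D :\ i0).
- by move: ltDn; rewrite (cardsD1 i0 D) i0D.
- move=> J sJ; rewrite bigcup_setD.
  have [->|J0] := eqVneq J set0; first by rewrite cards0.
  have sJD : J \subset D by apply: subset_trans sJ (subsetDl _ _).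
  have pJD : J \proper D.
    by rewrite properE sJD; apply/subsetPn; exists i0 => //; apply: contraTN sJ => i0J;
       apply/subsetPn; exists i0; rewrite // !inE eqxx.
  move/existsPn/(_ J): slack; rewrite J0 pJD /= => slack.
  have := hallD _ sJD; rewrite leq_eqVlt (negbTE slack) /= (cardsD1 x).
  by case: (x \in _); rewrite ?add1n ?ltnS // add0n => /ltnW.
have fx i : i \in D -> i != i0 -> f i != x.
  by move=> iD ne; have := fA i; rewrite !inE ne iD => /(_ isT)/andP[].
exists (fun i => if i == i0 then x else f i) => [i iD|i j iD jD].
  by case: eqP => [->//|/eqP ne]; have := fA i; rewrite !inE ne iD => /(_ isT)/andP[].
case: eqP => [->|/eqP ne]; case: eqP => [->|/eqP ne'] // eq_ij.
- by have := fx j jD ne'; rewrite -eq_ij eqxx.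
- by have := fx i iD ne; rewrite eq_ij eqxx.
- by apply: f_inj eq_ij; rewrite !inE ?ne ?ne'.
Qed.

(** * Necessity *)

(** Conjugating the entries of each [U k] trades the conjugate transpose for the transpose, which
    makes the equations polynomial in the unknowns. *)
Lemma achievable_bilinear (C : numClosedFieldType) K (M N : 'I_K -> nat) (H : channels C M N) d :
  achievable H d <-> exists (V : forall k, 'M[C]_(M k, d k)) (U : forall k, 'M[C]_(N k, d k)),
    (forall k j, j != k -> (U k)^T *m H k j *m V j = 0) /\
    (forall k, \rank ((U k)^T *m H k k *m V k) = d k).
Proof.
split=> -[V [U [HUV rk]]].
  exists V, (fun k => map_mx Num.conj (U k)).
  by split=> [k j /HUV|k]; [|apply: etrans (rk k)]; rewrite map_trmx.
exists V, (fun k => map_mx Num.conj (U k)).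
have UE k : (map_mx Num.conj (U k))^t* = (U k)^T.
  by apply/matrixP => i j; rewrite !mxE conjCK.
by split=> [k j /HUV|k]; [|apply: etrans (rk k)]; rewrite UE.
Qed.

Section Pivots.
Variables (R : nzRingType).

Definition pivot_mx n d (f : 'I_d -> 'I_n) : 'M[R]_(n, d) := \matrix_(r, a) (r == f a)%:R.

Lemma pivot_mul n d p (f : 'I_d -> 'I_n) (X : 'M[R]_(d, p)) a c :
  injective f -> (pivot_mx f *m X) (f a) c = X a c.
Proof.
move=> f_inj; rewrite mxE (bigD1 a) //= mxE eqxx mul1r big1 ?addr0 // => b ne.
by rewrite mxE (inj_eq f_inj) eq_sym (negbTE ne) mul0r.
Qed.

Lemma pivot_mul0 n d p (f : 'I_d -> 'I_n) (X : 'M[R]_(d, p)) r c :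
  r \notin codom f -> (pivot_mx f *m X) r c = 0.
Proof.
move=> rf; rewrite mxE big1 // => a _; rewrite mxE.
by case: eqP rf => [-> /negP[]|]; rewrite ?codom_f ?mul0r.
Qed.

Lemma tr_pivot_mul n d p (f : 'I_d -> 'I_n) (X : 'M[R]_(n, p)) a c :
  ((pivot_mx f)^T *m X) a c = X (f a) c.
Proof.
rewrite mxE (bigD1 (f a)) //= !mxE eqxx mul1r big1 ?addr0 // => r ne.
by rewrite !mxE (negbTE ne) mul0r.
Qed.

End Pivots.

(** A matrix of full column rank has [d] independent rows; [B] inverts the square block that they
    form. *)
Lemma pivot_normal (F : fieldType) n d (A : 'M[F]_(n, d)) : \rank A = d ->
  exists f : {ffun 'I_d -> 'I_n}, injective f /\
  exists B, (pivot_mx F f)^T *m (A *m B) = 1%:M.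
Proof.
move=> rkA; have fullA : row_full A by rewrite /row_full rkA.
exists (fullrankfun fullA); split; first exact: fullrankfun_inj.
exists (invmx (rowsub (fullrankfun fullA) A)).
rewrite mulmxA -[X in X *m _](_ : rowsub (fullrankfun fullA) A = _) ?mulmxV ?fullrowsub_unit //.
by apply/matrixP => a b; rewrite tr_pivot_mul mxE.
Qed.

(** * Parametrization of the aligned channels with prescribed pivots *)

Section Coordinates.
Variables (C : numClosedFieldType) (K : nat) (M N : 'I_K -> nat).

Definition position k j (r : 'I_(N k)) (c : 'I_(M j)) : coord M N :=
  @Tagged _ (k, j) (fun kj => ('I_(N kj.1) * 'I_(M kj.2))%type) (r, c).

Definition of_entries (v : coord M N -> C) : channels C M N :=
  fun k j => \matrix_(r, c) v (position r c).

Lemma of_entriesE v x : entry (of_entries v) x = v x.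
Proof. by case: x => -[k j] [r c]; rewrite /entry mxE. Qed.

Lemma eval_of_entries (p : {mpoly C[#|coord M N|]}) y :
  eval_channels p (of_entries (fun x => y (enum_rank x))) = p.@[y].
Proof. by apply: meval_eq => i; rewrite of_entriesE enum_valK. Qed.

Variables (d : nat) (I : {set 'I_K * 'I_K}).
Variables (f : forall k, {ffun 'I_d -> 'I_(N k)}) (g : forall k, {ffun 'I_d -> 'I_(M k)}).
Hypotheses (f_inj : forall k, injective (f k)) (g_inj : forall k, injective (g k)).

(* [(k, j) \in I] stands for the equation at receiver [j] for transmitter [k]. *)
Definition pivotal : pred (coord M N) := [pred x |
  (((tag x).2, (tag x).1) \in I) &&
  (((tagged x).1 \in codom (f (tag x).1)) && ((tagged x).2 \in codom (g (tag x).2)))].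
Definition free_rx : pred {j & ('I_(N j) * 'I_d)%type} := [pred y |
  [exists k, (k, tag y) \in I] && ((tagged y).1 \notin codom (f (tag y)))].
Definition free_tx : pred {k & ('I_(M k) * 'I_d)%type} := [pred y |
  [exists j, (tag y, j) \in I] && ((tagged y).1 \notin codom (g (tag y)))].
(** The variables of the parametrization: non-pivotal channel entries, then the free entries of [U]
    and of [V] for the users that occur in [I]. *)
Definition param := ({x | ~~ pivotal x} + {y | free_rx y} + {z | free_tx z})%type.

Lemma card_pivotal : #|pivotal| = (#|I| * (d * d))%N.
Proof.
rewrite -sum1_card /pivotal -(sig_big_dep (fun kj : 'I_K * 'I_K => ((kj.2, kj.1) \in I))
  (fun kj rc => (rc.1 \in codom (f kj.1)) && (rc.2 \in codom (g kj.2))) (fun _ _ => 1%N)) /=.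
transitivity (\sum_(kj : 'I_K * 'I_K | (kj.2, kj.1) \in I) d * d)%N.
  apply: eq_bigr => kj _; rewrite sum1_card.
  have /= := cardX (mem (codom (f kj.1))) (mem (codom (g kj.2))).
  rewrite (card_codom (@f_inj kj.1)) (card_codom (@g_inj kj.2)) card_ord => <-.
  exact: eq_card.
rewrite sum_nat_const; congr (_ * _)%N.
(* The tag of a coordinate lists the receiver first, whereas [I] lists the transmitter first; the
   swap is injective and keeps the count. *)
rewrite -[RHS](card_imset _ (can_inj (fun kj => _ : (fun kj => (kj.2, kj.1)) (kj.2, kj.1) = kj))); last by case.
by apply: eq_card => -[k j]; apply/idP/imsetP => [kjI|[[a b] abI [-> ->]]//]; exists (j, k).
Qed.

Lemma card_free_rx : #|free_rx| = (\sum_(j | [exists k, (k, j) \in I]) (N j - d) * d)%N.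
Proof.
rewrite -sum1_card /free_rx -(sig_big_dep (fun j => [exists k, (k, j) \in I])
  (fun j (ra : 'I_(N j) * 'I_d) => ra.1 \notin codom (f j)) (fun _ _ => 1%N)) /=.
apply: eq_bigr => j _; rewrite sum1_card.
have := cardX (predC (mem (codom (f j)))) 'I_d; rewrite card_ord.
have -> : #|predC (mem (codom (f j)))| = (N j - d)%N.
  by rewrite -[X in (X - d)%N]card_ord -(cardC (mem (codom (f j)))) (card_codom (@f_inj j)) card_ord addKn.
by move=> <-; apply: eq_card => -[r a]; rewrite !inE andbT.
Qed.

Lemma card_free_tx : #|free_tx| = (\sum_(k | [exists j, (k, j) \in I]) (M k - d) * d)%N.
Proof.
rewrite -sum1_card /free_tx -(sig_big_dep (fun k => [exists j, (k, j) \in I])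
  (fun k (ra : 'I_(M k) * 'I_d) => ra.1 \notin codom (g k)) (fun _ _ => 1%N)) /=.
apply: eq_bigr => j _; rewrite sum1_card.
have := cardX (predC (mem (codom (g j)))) 'I_d; rewrite card_ord.
have -> : #|predC (mem (codom (g j)))| = (M j - d)%N.
  by rewrite -[X in (X - d)%N]card_ord -(cardC (mem (codom (g j)))) (card_codom (@g_inj j)) card_ord addKn.
by move=> <-; apply: eq_card => -[r a]; rewrite !inE andbT.
Qed.


(** The non-pivotal entries count on both sides. What remains compares the free entries of [U] and
    [V] with the [#|I| * d * d] pivotal entries, which is [d] times the assumed inequality. *)
Lemma card_param_lt : (0 < d)%N ->
  (\sum_(k | [exists j, (k, j) \in I]) (M k - d) +
   \sum_(j | [exists k, (k, j) \in I]) (N j - d) < #|I| * d)%N ->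
  (#|{: param}| < #|coord M N|)%N.
Proof.
move=> d0 lt_sum; rewrite !card_sum !card_sig.
rewrite [X in (_ + X)%N](_ : _ = #|free_tx|) ?[X in (_ + X + _)%N](_ : _ = #|free_rx|);
  try by apply: eq_card.
have := cardC pivotal; rewrite card_pivotal => <-.
rewrite card_free_tx card_free_rx -!big_distrl /=.
rewrite -addnA addnC [X in (_ < X)%N](_ : _ = #|I| * d * d + #|predC pivotal|)%N ?ltn_add2r ?mulnA //.
by rewrite -mulnDl ltn_pmul2r // addnC.
Qed.

(** The value 0 outside [P] blanks the pivotal entries in [channel_mx] and leaves the pivot rows of
    [rx_mx] and [tx_mx] to the identity. *)
Definition free_var (T : finType) (P : pred T) (inj : {x | P x} -> param) x : {mpoly C[#|{: param}|]} :=
  if insub x is Some u then 'X_(enum_rank (inj u)) else 0.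

Definition channel_mx j k : 'M_(N j, M k) :=
  \matrix_(r, c) free_var (fun u => inl (inl u)) (@position j k r c).
Definition rx_mx j : 'M_(N j, d) := pivot_mx _ (f j) +
  \matrix_(r, a) free_var (fun u => inl (inr u)) (@Tagged _ j (fun j => ('I_(N j) * 'I_d)%type) (r, a)).
Definition tx_mx k : 'M_(M k, d) := pivot_mx _ (g k) +
  \matrix_(r, a) free_var (fun u => inr u) (@Tagged _ k (fun k => ('I_(M k) * 'I_d)%type) (r, a)).

(* The equation [U^T H V = 0] with [U], [V] the identity on the pivots, solved for the
   pivotal entries of [H]. *)
Definition solved_mx j k : 'M_(N j, M k) := channel_mx j k -
  (if (k, j) \in I then
     pivot_mx _ (f j) *m ((rx_mx j)^T *m channel_mx j k *m tx_mx k) *m (pivot_mx _ (g k))^T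
   else 0).

(** The parameters are read off from [H], [U] and [V]. Blanking the pivotal block [P] of [H] turns
    [U^T H V = 0] into [- P], because [U] and [V] are the identity on the pivots; subtracting this
    in [solved_mx] restores [P]. *)
Lemma aligned_parametrized (H : channels C M N)
    (V : forall k, 'M[C]_(M k, d)) (U : forall k, 'M[C]_(N k, d)) :
    (forall k, (pivot_mx C (f k))^T *m U k = 1%:M) ->
    (forall k, (pivot_mx C (g k))^T *m V k = 1%:M) ->
    (forall k j, (k, j) \in I -> (U j)^T *m H j k *m V k = 0) ->
  exists y, forall j k, map_mx (meval y) (solved_mx j k) = H j k.
Proof.
move=> U1 V1 HUV.
pose y (i : 'I_#|{: param}|) := match enum_val i with
  | inl (inl u) => entry H (val u)
  | inl (inr u) => U (tag (val u)) (tagged (val u)).1 (tagged (val u)).2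
  | inr u => V (tag (val u)) (tagged (val u)).1 (tagged (val u)).2
  end.
exists y => j k.
have map_pivot n (e : 'I_d -> 'I_n) : map_mx (meval y) (pivot_mx _ e) = pivot_mx C e.
  by apply/matrixP => r a; rewrite !mxE rmorph_nat.
have HE r c : (map_mx (meval y) (channel_mx j k)) r c =
    if pivotal (position r c) then 0 else H j k r c.
  rewrite !mxE /free_var; case: insubP => [u np uE|].
    by rewrite mevalXU /y enum_rankK uE (negbTE np).
  by rewrite negbK => ->; rewrite meval0.
rewrite map_mxB; have [kjI|kjI] := ifPn; last first.
  by rewrite raddf0 subr0; apply/matrixP => r c; rewrite HE /pivotal /= (negbTE kjI).
rewrite !map_mxM -!map_trmx !map_pivot.
have UE : map_mx (meval y) (rx_mx j) = U j.
  rewrite map_mxD map_pivot; apply/matrixP => r a; rewrite !mxE /free_var.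
  have jI : [exists k, (k, j) \in I] by apply/existsP; exists k.
  case: insubP => [u + uE|]; rewrite /free_rx /= jI /= ?negbK.
    rewrite mevalXU /y enum_rankK uE /=.
    by case: eqP => [-> /negP[]|_]; rewrite ?codom_f ?add0r.
  case/codomP => b ->; rewrite meval0 addr0 (inj_eq (@f_inj j)).
  by have := congr1 (fun A : 'M_d => A b a) (U1 j); rewrite tr_pivot_mul mxE => ->.
have VE : map_mx (meval y) (tx_mx k) = V k.
  rewrite map_mxD map_pivot; apply/matrixP => r a; rewrite !mxE /free_var.
  have kI : [exists j, (k, j) \in I] by apply/existsP; exists j.
  case: insubP => [u + uE|]; rewrite /free_tx /= kI /= ?negbK.
    rewrite mevalXU /y enum_rankK uE /=.
    by case: eqP => [-> /negP[]|_]; rewrite ?codom_f ?add0r.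
  case/codomP => b ->; rewrite meval0 addr0 (inj_eq (@g_inj k)).
  by have := congr1 (fun A : 'M_d => A b a) (V1 k); rewrite tr_pivot_mul mxE => ->.
rewrite UE VE; pose P := (pivot_mx C (f j))^T *m H j k *m pivot_mx C (g k).
have H0E : map_mx (meval y) (channel_mx j k) =
    H j k - pivot_mx C (f j) *m P *m (pivot_mx C (g k))^T.
  apply/matrixP => r c; rewrite HE /pivotal /= kjI /=.
  rewrite [in RHS]mxE [X in _ + X]mxE -mulmxA.
  have [/codomP[a ->]|rf] /= := boolP (r \in codom _); last by rewrite pivot_mul0 // subr0.
  rewrite pivot_mul // -[P *m _]trmxK trmx_mul trmxK [in RHS]mxE.
  have [/codomP[b ->]|cg] /= := boolP (c \in codom _); last by rewrite pivot_mul0 // subr0.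
  rewrite pivot_mul // mxE /P -mulmxA tr_pivot_mul.
  by rewrite -[H j k *m _]trmxK trmx_mul mxE tr_pivot_mul mxE subrr.
have -> : (U j)^T *m map_mx (meval y) (channel_mx j k) *m V k = - P.
  rewrite H0E mulmxBr mulmxBl HUV // sub0r; congr (- _).
  rewrite -!mulmxA V1 mulmx1 mulmxA -[X in X *m _]trmxK trmx_mul trmxK U1.
  by rewrite trmx1 mul1mx mulmxA.
by rewrite H0E mulmxN mulNmx opprK subrK.
Qed.

(** The entries of the matrices [solved_mx] outnumber the parameters, so they satisfy a nonzero
    polynomial relation [q], which then holds on every channel that they parametrize. *)
Lemma aligned_vanishing : (0 < d)%N ->
    (\sum_(k | [exists j, (k, j) \in I]) (M k - d) +
     \sum_(j | [exists k, (k, j) \in I]) (N j - d) < #|I| * d)%N ->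
  exists2 q : {mpoly C[#|coord M N|]}, q != 0 &
    forall (H : channels C M N) (V : forall k, 'M[C]_(M k, d)) (U : forall k, 'M[C]_(N k, d)),
      (forall k, (pivot_mx C (f k))^T *m U k = 1%:M) ->
      (forall k, (pivot_mx C (g k))^T *m V k = 1%:M) ->
      (forall k j, (k, j) \in I -> (U j)^T *m H j k *m V k = 0) ->
    eval_channels q H = 0.
Proof.
move=> d0 lt_sum; pose F := [tuple (let x := enum_val i in
  solved_mx (tag x).1 (tag x).2 (tagged x).1 (tagged x).2) | i < #|coord M N|].
have [q q0 qF] := mpoly_alg_dep F (card_param_lt d0 lt_sum).
exists q => // H V U U1 V1 HUV; have [y yH] := aligned_parametrized U1 V1 HUV.
have := congr1 (meval y) qF; rewrite meval0 comp_mpoly_meval => <-.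
apply: meval_eq => i; rewrite tnth_mktuple /entry.
by rewrite -yH mxE.
Qed.

End Coordinates.

Lemma generic_alignment_bound (C : numClosedFieldType) K (M N : 'I_K -> nat) d
    (I : {set 'I_K * 'I_K}) :
    (0 < d)%N -> I \subset [set kj | kj.1 != kj.2] ->
    generically (fun H : channels C M N => achievable H (fun=> d)) ->
  (#|I| * d <= \sum_(k | [exists j, (k, j) \in I]) (M k - d) +
               \sum_(j | [exists k, (k, j) \in I]) (N j - d))%N.
Proof.
move=> d0 /subsetP Ioff [O [[S OS] [H0 OH0] achO]]; rewrite leqNgt; apply/negP => lt_sum.
(* An equation of the complement that fails at [H0]; off its zeros every channel lies in [O]. *)
have [p [pS pH0]] : exists p, S p /\ eval_channels p H0 <> 0.
  apply: contrapT => noS; case: (OS H0) => _; apply=> // p pS.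
  by apply: contrapT => pH0; apply: noS; exists p.
have pO H : eval_channels p H != 0 -> O H.
  by move/eqP=> pH; apply: contrapT => /OS/(_ p pS).
pose pivots := ({dffun forall k, {ffun 'I_d -> 'I_(N k)}} * {dffun forall k, {ffun 'I_d -> 'I_(M k)}})%type.
pose inj (s : pivots) := (forall k, injective (s.1 k)) /\ (forall k, injective (s.2 k)).
pose aligned (s : pivots) (H : channels C M N) (V : forall k, 'M[C]_(M k, d)) (U : forall k, 'M[C]_(N k, d)) :=
  [/\ forall k, (pivot_mx C (s.1 k))^T *m U k = 1%:M,
      forall k, (pivot_mx C (s.2 k))^T *m V k = 1%:M &
      forall k j, (k, j) \in I -> (U j)^T *m H j k *m V k = 0].
have /fin_all_exists[q qP] (s : pivots) : exists q : {mpoly C[#|coord M N|]}, q != 0 /\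
    (inj s -> forall H V U, aligned s H V U -> eval_channels q H = 0).
  have [[inj1 inj2]|ninj] := pselect (inj s); last first.
    by exists 1; rewrite oner_neq0.
  have [q q0 qv] := @aligned_vanishing C K M N d I s.1 s.2 inj1 inj2 d0 lt_sum.
  by exists q; split=> // _ H V U [U1 V1 HUV]; apply: qv HUV.
have p0 : p != 0 by apply/eqP => p0; apply: pH0; rewrite p0 /eval_channels meval0.
(* Pivot choices form a finite type, so one channel can avoid [p = 0] and the hypersurfaces of all
   choices at once. *)
have /mpoly_nonroot[y] : p * \prod_s q s != 0.
  by rewrite mulf_neq0 //; apply/prodf_neq0 => s _; case: (qP s).
rewrite mevalM mulf_eq0 negb_or rmorph_prod => /andP[py /prodf_neq0 qy].
rewrite -eval_of_entries in py.
have [V [U [HUV rkUV]]] := (achievable_bilinear _ _).1 (achO _ (pO _ py)).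
(* [U k] and [V k] inherit rank [d] from the direct product, so both have pivot rows. *)
have rkU k : \rank (U k) = d.
  apply/eqP; rewrite eqn_leq rank_leq_col -{1}(rkUV k) -mulmxA -(mxrank_tr (U k)).
  exact: mxrankM_maxl.
have rkV k : \rank (V k) = d.
  by apply/eqP; rewrite eqn_leq rank_leq_col -{1}(rkUV k) mxrankM_maxr.
have /fin_all_exists[f /all_and2[f_inj /fin_all_exists[B BP]]] k := pivot_normal (rkU k).
have /fin_all_exists[g /all_and2[g_inj /fin_all_exists[B' BP']]] k := pivot_normal (rkV k).
pose s : pivots := ([ffun k => f k], [ffun k => g k]).
have s1 k : s.1 k = f k by rewrite ffunE.
have s2 k : s.2 k = g k by rewrite ffunE.
have /negP[] := qy s isT; rewrite /= -eval_of_entries; apply/eqP.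
have [_ /(_ _ _ (fun k => V k *m B' k) (fun k => U k *m B k))] := qP s.
apply; first by split=> k; rewrite ?s1 ?s2.
split=> [k|k|k j /Ioff]; rewrite ?s1 ?s2 // inE /= => ne_kj.
(* Normalization multiplies [U j] and [V k] on the right, which keeps the alignment equations. *)
transitivity ((B j)^T *m ((U j)^T *m of_entries (fun x => y (enum_rank x)) j k *m V k) *m B' k).
  by rewrite trmx_mul !mulmxA.
by rewrite HUV // mulmx0 mul0mx.
Qed.

(** * Sufficiency *)

(** The rank condition becomes polynomial with an extra unknown [Wx k], inverse to [U^T H V] on the
    diagonal; then [solvable_generic] applies to the whole system. *)
Lemma achievable_generic (C : numClosedFieldType) K (M N : 'I_K -> nat) d :
  exists2 h : {mpoly C[#|coord M N|]}, h != 0 &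
    (forall H : channels C M N, eval_channels h H != 0 -> achievable H (fun=> d)) \/
    (forall H : channels C M N, eval_channels h H != 0 -> ~ achievable H (fun=> d)).
Proof.
pose aux := (({k & 'I_(M k) * 'I_d} + {k & 'I_(N k) * 'I_d}) + 'I_K * ('I_d * 'I_d))%type.
pose n := #|coord M N|; pose m := #|{: aux}|.
pose vx (z : aux) : {mpoly C[n + m]} := 'X_(rshift n (enum_rank z)).
pose Hx k j : 'M_(N k, M j) := \matrix_(r, c) ('X_(lshift m (enum_rank (position r c))) : {mpoly C[n + m]}).
pose iV k r a : aux := inl (inl (@Tagged _ k (fun k => ('I_(M k) * 'I_d)%type) (r, a))).
pose iU k r a : aux := inl (inr (@Tagged _ k (fun k => ('I_(N k) * 'I_d)%type) (r, a))).
pose iW k a b : aux := inr (k, (a, b)).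
pose Vx k := \matrix_(r, a) vx (iV k r a).
pose Ux k := \matrix_(r, a) vx (iU k r a).
pose Wx k := \matrix_(a, b) vx (iW k a b).
pose p (e : ('I_K * 'I_K) * ('I_d * 'I_d)) : {mpoly C[n + m]} :=
  (if e.1.2 == e.1.1 then Wx e.1.1 *m ((Ux e.1.1)^T *m Hx e.1.1 e.1.1 *m Vx e.1.1) - 1%:M
   else (Ux e.1.1)^T *m Hx e.1.1 e.1.2 *m Vx e.1.2) e.2.1 e.2.2.
have [h h0 hP] := solvable_generic p; exists h => //.
suff sol H : achievable H (fun=> d) <->
    exists x, forall e, (p e).@[cat_env (fun i => entry H (enum_val i)) x] = 0.
  by case: hP => hP; [left|right] => H hH; [apply/sol | move/sol]; apply: hP hH.
pose y (i : 'I_n) := entry H (enum_val i).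
have evalV x k : map_mx (meval (cat_env y x)) (Vx k) = \matrix_(r, a) x (enum_rank (iV k r a)).
  by apply/matrixP => r a; rewrite !mxE mevalXU /cat_env (unsplitK (inr _)).
have evalU x k : map_mx (meval (cat_env y x)) (Ux k) = \matrix_(r, a) x (enum_rank (iU k r a)).
  by apply/matrixP => r a; rewrite !mxE mevalXU /cat_env (unsplitK (inr _)).
have evalW x k : map_mx (meval (cat_env y x)) (Wx k) = \matrix_(a, b) x (enum_rank (iW k a b)).
  by apply/matrixP => r a; rewrite !mxE mevalXU /cat_env (unsplitK (inr _)).
have evalH x k j : map_mx (meval (cat_env y x)) (Hx k j) = H k j.
  by apply/matrixP => r a; rewrite !mxE mevalXU /cat_env (unsplitK (inl _)) /y enum_rankK.
have evalp x (V : forall k, 'M_(M k, d)) (U : forall k, 'M_(N k, d)) (W : 'I_K -> 'M_d) :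
    (forall k, map_mx (meval (cat_env y x)) (Vx k) = V k) ->
    (forall k, map_mx (meval (cat_env y x)) (Ux k) = U k) ->
    (forall k, map_mx (meval (cat_env y x)) (Wx k) = W k) ->
    (forall e, (p e).@[cat_env y x] = 0) <->
    (forall k j, j != k -> (U k)^T *m H k j *m V j = 0) /\
    (forall k, W k *m ((U k)^T *m H k k *m V k) = 1%:M).
  move=> VE UE WE.
  have UHV k j : map_mx (meval (cat_env y x)) ((Ux k)^T *m Hx k j *m Vx j) = (U k)^T *m H k j *m V j.
    by rewrite !map_mxM -map_trmx UE VE evalH.
  have pE k j a b : (p ((k, j), (a, b))).@[cat_env y x] =
      (if j == k then W k *m ((U k)^T *m H k k *m V k) - 1%:M else (U k)^T *m H k j *m V j) a b.
    rewrite /p /=; case: ifP => _; last by rewrite -UHV [RHS]mxE.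
    by rewrite -UHV -WE -map_mxM -(map_mx1 (meval (cat_env y x))) -map_mxB [RHS]mxE.
  split=> [pe0|[offd diag] [[k j] [a b]]]; last first.
    by rewrite pE; case: eqVneq => [_|/offd ->]; rewrite ?diag ?subrr mxE.
  split=> [k j ne|k].
    by apply/matrixP => a b; have := pe0 ((k, j), (a, b)); rewrite pE (negbTE ne) => ->; rewrite mxE.
  by apply/eqP; rewrite -subr_eq0; apply/eqP/matrixP => a b;
     have := pe0 ((k, k), (a, b)); rewrite pE eqxx => ->; rewrite mxE.
rewrite achievable_bilinear; split=> [[V [U [offd rk]]]|[x]].
  pose W k := invmx ((U k)^T *m H k k *m V k).
  pose x (i : 'I_m) := match enum_val i with
    | inl (inl u) => V (tag u) (tagged u).1 (tagged u).2
    | inl (inr u) => U (tag u) (tagged u).1 (tagged u).2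
    | inr u => W u.1 u.2.1 u.2.2
    end.
  exists x; apply/(evalp x V U W).
  - by move=> k; rewrite evalV; apply/matrixP => r a; rewrite mxE /x enum_rankK.
  - by move=> k; rewrite evalU; apply/matrixP => r a; rewrite mxE /x enum_rankK.
  - by move=> k; rewrite evalW; apply/matrixP => r a; rewrite mxE /x enum_rankK.
  by split=> // k; rewrite mulVmx // -row_free_unit /row_free rk.
move/(evalp x _ _ _ (evalV x) (evalU x) (evalW x)) => [offd diag].
do 2!eexists; split; first exact: offd.
by move=> k; apply/eqP; have /mulmx1_unit[_] := diag k; rewrite -row_free_unit.
Qed.

(** * Assignment of the equations to free blocks *)

Lemma card_ord_gt0 c : #|[pred l : 'I_c | (0 < l)%N]| = c.-1.
Proof.
case: c => [|c]; first by apply: eq_card0 => -[].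
by rewrite -[c.+1 in RHS]card_ord -(cardC1 (@ord0 c)); apply: eq_card => l; rewrite !inE lt0n.
Qed.

(* Each equation is charged to one endpoint, the boolean telling which; the endpoint [v]
   offers the slots [1, ..., cap v - 1], to be used at most once. *)
Lemma slot_assignment K (cap : bool -> 'I_K -> nat) (D : {set 'I_K * 'I_K}) :
    (forall b k, (0 < cap b k)%N) ->
    (forall I : {set 'I_K * 'I_K}, I \subset D ->
      (#|I| <= \sum_(k | [exists j, (k, j) \in I]) (cap true k).-1 +
               \sum_(j | [exists k, (k, j) \in I]) (cap false j).-1)%N) ->
  exists (s : 'I_K -> 'I_K -> bool) (l : 'I_K -> 'I_K -> nat),
  [/\ forall k j, (k, j) \in D -> (0 < l k j < cap (s k j) (if s k j then k else j))%N,
      forall k j j', (k, j) \in D -> (k, j') \in D -> s k j -> s k j' -> l k j = l k j' -> j = j' &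
      forall j k k', (k, j) \in D -> (k', j) \in D -> ~~ s k j -> ~~ s k' j -> l k j = l k' j -> k = k'].
Proof.
move=> cap0 hallD.
have [D0|[[k0 _] _]] := set_0Vmem D.
  by exists (fun _ _ => true), (fun _ _ => 0%N); split=> [k j|k j j'|j k k']; rewrite D0 inE.
pose S := {v : bool * 'I_K & 'I_(cap v.1 v.2)}.
have S_inj (x x' : S) : tag x = tag x' -> tagged x = tagged x' :> nat -> x = x'.
  by case: x x' => [v l] [v' l'] /= ev; case: _ / ev l' => l' /val_inj ->.
have v0 : 'I_(cap true k0) by exact: Ordinal (cap0 true k0).
(* [true] marks the transmitter end of an equation and [false] the receiver end; slot 0 is reserved
   for the pivots. *)
pose A (e : 'I_K * 'I_K) : {set S} :=
  [set x : S | (tag x \in [:: (true, e.1); (false, e.2)]) && (0 < tagged x)%N].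
have [I sID|f fA f_inj] := @hall_marriage _ _ (@Tagged _ (true, k0) (fun v => 'I_(cap v.1 v.2)) v0 : S) A D.
  pose P (I : {set 'I_K * 'I_K}) (v : bool * 'I_K) :=
    if v.1 then [exists j, (v.2, j) \in I] else [exists k, (k, v.2) \in I].
  apply: leq_trans (hallD I sID) _.
  (* The neighbours of [I] are exactly the positive slots at the endpoints that occur in [I]. *)
  rewrite (eq_card (B := [pred x : S | P I (tag x) && (0 < tagged x)%N])); last first.
    move=> [[b v] l]; rewrite !inE; apply/bigcupP/andP => /= [[[k j] kjI]|[]].
      rewrite !inE /= => /andP[/orP[]/eqP[eb ev] l0]; split=> //; rewrite /P /= eb ev; apply/existsP.
        by exists j.
      by exists k.
    rewrite /P /=; case: b l => l /existsP[u uI] l0.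
      by exists (v, u); rewrite // !inE eqxx.
    by exists (u, v); rewrite // !inE eqxx orbT.
  rewrite -sum1_card -(sig_big_dep (P I) (fun v (l : 'I_(cap v.1 v.2)) => (0 < l)%N) (fun _ _ => 1%N)) /=.
  under [leqRHS]eq_bigr do rewrite sum1_card card_ord_gt0.
  by rewrite -(pair_big_dep xpredT (fun b k => P I (b, k)) (fun b k => (cap b k).-1)) /= big_bool.
have tag_f e : e \in D -> tag (f e) = if (tag (f e)).1 then (true, e.1) else (false, e.2).
  by move/fA; rewrite !inE => /andP[+ _] => /orP[]/eqP->.
exists (fun k j => (tag (f (k, j))).1), (fun k j => val (tagged (f (k, j)))); split.
- move=> k j /fA; rewrite !inE; case: (f _) => -[b v] l /=.
  case/andP => bv ->; have -> : (if b then k else j) = v by case/orP: bv => /eqP[-> ->].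
  exact: ltn_ord.
- move=> k j j' kj kj' b b' eq_l.
  have eq_t : tag (f (k, j)) = tag (f (k, j')) by rewrite (tag_f _ kj) (tag_f _ kj') b b'.
  by have [] := f_inj _ _ kj kj' (S_inj _ _ eq_t eq_l).
- move=> j k j' kj kj' /negbTE b /negbTE b' eq_l.
  have eq_t : tag (f (k, j)) = tag (f (j', j)) by rewrite (tag_f _ kj) (tag_f _ kj') b b'.
  by have [] := f_inj _ _ kj kj' (S_inj _ _ eq_t eq_l).
Qed.

(** The identity in the [l]-th block of [d] rows; slot 0 will carry the pivots and the other slots
    the free blocks. *)
Definition slot_mx (R : nzRingType) n d l : 'M[R]_(n, d) :=
  \matrix_(r, c) (r == l * d + c :> nat)%:R.

Lemma slot_mxM (R : nzRingType) n d l l' : (l < n %/ d)%N ->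
  (slot_mx R n d l)^T *m slot_mx R n d l' = (l == l')%:R%:M.
Proof.
move=> l_lt; apply/matrixP => a b; rewrite !mxE.
have d0 : (0 < d)%N by case: d a {b l_lt} => // -[].
have la : (l * d + a < n)%N.
  apply: leq_trans (leq_trunc_div n d); apply: leq_trans (_ : l.+1 * d <= _)%N.
    by rewrite mulSn addnC ltn_add2r.
  by rewrite leq_pmul2r.
rewrite (bigD1 (Ordinal la)) //= !mxE eqxx mul1r big1 ?addr0 => [|r ne]; last first.
  rewrite !mxE; case: eqP => [rE|_]; last by rewrite mul0r.
  by case/eqP: ne; apply: val_inj.
have -> : (l * d + a == l' * d + b)%N = (l == l') && (a == b).
  apply/eqP/andP => [eq_lab|[/eqP-> /eqP->]] //.
  have eq_l : l = l'.
    by have := congr1 (divn^~ d) eq_lab; rewrite !divnMDl // !divn_small // !addn0.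
  by move: eq_lab; rewrite eq_l eqxx => /addnI/val_inj ->.
by case: (l == l') => /=; case: (a == b).
Qed.

(** * Curves of achievable channels *)

Section Curve.
Variables (C : numClosedFieldType) (K : nat) (M N : 'I_K -> nat) (d : nat).
Variables (s : 'I_K -> 'I_K -> bool) (l : 'I_K -> 'I_K -> nat).
Hypotheses (M_ge : forall k, (0 < M k %/ d)%N) (N_ge : forall k, (0 < N k %/ d)%N).
Hypothesis l_range : forall k j, k != j ->
  (0 < l k j < if s k j then M k %/ d else N j %/ d)%N.
Hypothesis l_inj_tx : forall k j j', k != j -> k != j' -> s k j -> s k j' -> l k j = l k j' -> j = j'.
Hypothesis l_inj_rx : forall j k k', k != j -> k' != j -> ~~ s k j -> ~~ s k' j -> l k j = l k' j -> k = k'.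

Local Notation E j := (slot_mx C (N j) d 0).
Local Notation F k := (slot_mx C (M k) d 0).
Local Notation SN k j := (slot_mx C (N j) d (l k j)).
Local Notation SM k j := (slot_mx C (M k) d (l k j)).

(** A direct channel joins pivots to pivots, so that its signal is the identity. A cross channel
    joins the pivots of one user to the slot of the user charged with the equation, so only that
    slot enters the linearized equation. *)
Definition base : channels C M N := fun j k =>
  if j == k then E j *m (F k)^T
  else if s k j then E j *m (SM k j)^T else SN k j *m (F k)^T.

Variable Z : channels C M N.

(** [tx_dir] and [rx_dir] solve the alignment equations linearized at [base], with right-hand side
    given by [Z]: each equation is solved in its own slot. *)
Definition tx_dir k : 'M[C]_(M k, d) :=
  - \sum_(j | (k != j) && s k j) SM k j *m ((E j)^T *m Z j k *m F k).
Definition rx_dir j : 'M[C]_(N j, d) :=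
  - \sum_(k | (k != j) && ~~ s k j) SN k j *m ((E j)^T *m Z j k *m F k)^T.

Let l_gt0 k j : k != j -> (l k j == 0)%N = false.
Proof. by move/l_range => /andP[]; case: (l k j). Qed.

Lemma EE j : (E j)^T *m E j = 1%:M. Proof. by rewrite slot_mxM. Qed.
Lemma FF k : (F k)^T *m F k = 1%:M. Proof. by rewrite slot_mxM. Qed.
Lemma ESN k j : k != j -> (E j)^T *m SN k j = 0.
Proof. by move=> kj; rewrite slot_mxM // eq_sym l_gt0 // raddf0. Qed.
Lemma FSM k j : k != j -> (F k)^T *m SM k j = 0.
Proof. by move=> kj; rewrite slot_mxM // eq_sym l_gt0 // raddf0. Qed.

Lemma E_rx j : (E j)^T *m rx_dir j = 0.
Proof.
rewrite mulmxN mulmx_sumr big1 ?oppr0 // => k /andP[kj _].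
by rewrite mulmxA ESN // mul0mx.
Qed.

Lemma F_tx k : (F k)^T *m tx_dir k = 0.
Proof.
rewrite mulmxN mulmx_sumr big1 ?oppr0 // => j /andP[kj _].
by rewrite (mulmxA _ (slot_mx _ _ _ _)) FSM // mul0mx.
Qed.

Lemma rx_E j : (rx_dir j)^T *m E j = 0.
Proof. by apply: trmx_inj; rewrite trmx_mul trmxK E_rx trmx0. Qed.

Lemma base_pivot k j : k != j -> (E j)^T *m base j k *m F k = 0.
Proof.
move=> kj; rewrite /base eq_sym (negbTE kj); have := l_range kj; case: ifPn => _ /andP[_ lkj].
  by rewrite -!mulmxA slot_mxM // l_gt0 // raddf0 !mulmx0.
by rewrite mulmxA ESN // !mul0mx.
Qed.

(** Only the charged endpoint contributes. Distinct slots are orthogonal and no two equations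
    charged to it share a slot, so its sum retains just the term of [(k, j)]. *)
Lemma base_dir k j : k != j ->
  (rx_dir j)^T *m base j k *m F k + (E j)^T *m base j k *m tx_dir k = - ((E j)^T *m Z j k *m F k).
Proof.
move=> kj; rewrite /base eq_sym (negbTE kj); have := l_range kj; case: ifPn => skj /andP[_ lkj].
  rewrite !mulmxA rx_E !mul0mx add0r EE mul1mx /tx_dir mulmxN; congr (- _).
  rewrite mulmx_sumr (bigD1 j) ?kj //= (mulmxA _ (slot_mx _ _ _ _)) slot_mxM // eqxx mul1mx.
  rewrite big1 ?addr0 // => j' /andP[/andP[kj' skj'] ne].
  rewrite (mulmxA _ (slot_mx _ _ _ _)) slot_mxM //; case: eqP => [/(l_inj_tx kj kj' skj skj') eq_j|_].
    by rewrite eq_j eqxx in ne.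
  by rewrite raddf0 mul0mx.
rewrite !mulmxA ESN // !mul0mx addr0 -mulmxA FF mulmx1 /rx_dir raddfN mulNmx; congr (- _).
rewrite raddf_sum mulmx_suml (bigD1 k) ?kj ?skj //= trmx_mul trmxK -(mulmxA _ (slot_mx _ _ _ (l _ _))^T) slot_mxM // eqxx mulmx1.
rewrite big1 ?addr0 // => k' /andP[/andP[kj' skj'] ne].
have := l_range kj'; rewrite (negbTE skj') => /andP[_ lkj'].
rewrite trmx_mul trmxK -(mulmxA _ (slot_mx _ _ _ (l _ _))^T) slot_mxM //; case: eqP => [/(l_inj_rx kj' kj skj' skj) eq_k|_].
  by rewrite eq_k eqxx in ne.
by rewrite raddf0 mulmx0.
Qed.

(** [residue0] and [residue1] place at the pivots the coefficients of [t^2] and [t^3] in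
    [U^T (base + t Z) V], where [U = E + t rx_dir] and [V = F + t tx_dir]. *)
Definition residue0 : channels C M N := fun j k => if j == k then 0 else
  E j *m ((rx_dir j)^T *m Z j k *m F k + (E j)^T *m Z j k *m tx_dir k
          + (rx_dir j)^T *m base j k *m tx_dir k) *m (F k)^T.
Definition residue1 : channels C M N := fun j k => if j == k then 0 else
  E j *m ((rx_dir j)^T *m Z j k *m tx_dir k) *m (F k)^T.

(* Subtracting the residues cancels the terms of order [t^2] and [t^3] in the alignment
   equations of [E + t rx_dir] and [F + t tx_dir]. *)
Definition curve (t : C) : channels C M N := fun j k =>
  base j k + t *: (Z j k - t *: (residue0 j k + t *: residue1 j k)).

(** A block at the pivots passes through [U] and [V] unchanged, so a correction creates no terms of
    higher order. *)
Lemma residue_sandwich j k (U : 'M_(N j, d)) (V : 'M_(M k, d)) (P Q : 'M_d) t :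
    U^T *m E j = 1%:M -> (F k)^T *m V = 1%:M ->
  U^T *m (t *: (t *: (E j *m P *m (F k)^T + t *: (E j *m Q *m (F k)^T)))) *m V
  = t *: (t *: (P + t *: Q)).
Proof.
move=> UE FV.
have sandwich X : U^T *m (E j *m X *m (F k)^T) *m V = X.
  by rewrite !mulmxA UE mul1mx -mulmxA FV mulmx1.
by rewrite -!scalemxAr -!scalemxAl mulmxDr mulmxDl -scalemxAr -scalemxAl !sandwich.
Qed.

Lemma curve_aligned t k j : k != j ->
  (E j + t *: rx_dir j)^T *m curve t j k *m (F k + t *: tx_dir k) = 0.
Proof.
move=> kj; set U := E j + _; set V := F k + _.
have UT : U^T = (E j)^T + t *: (rx_dir j)^T by rewrite /U linearD linearZ.
have UE : U^T *m E j = 1%:M by rewrite UT mulmxDl EE -scalemxAl rx_E scaler0 addr0.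
have FV : (F k)^T *m V = 1%:M by rewrite /V mulmxDr FF -scalemxAr F_tx scaler0 addr0.
rewrite /curve /residue0 /residue1 eq_sym (negbTE kj).
set R0 := _ + _ + _; set R1 := _ *m _ *m tx_dir k.
transitivity (U^T *m (base j k + t *: Z j k) *m V - t *: (t *: (R0 + t *: R1))).
  by rewrite scalerBr addrA mulmxBr mulmxBl (residue_sandwich _ _ _ UE FV).
(* By order in [t]: the constant term vanishes by [base_pivot], the linear one by [base_dir], and
   the rest cancels against the residues. *)
rewrite UT /V !(mulmxDl, mulmxDr) -!(scalemxAl, scalemxAr) !scalerA.
rewrite base_pivot // /R0 /R1.
have := base_dir kj.
move: ((rx_dir j)^T *m base j k *m F k) ((E j)^T *m base j k *m tx_dir k) ((E j)^T *m Z j k *m F k)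
  ((rx_dir j)^T *m Z j k *m F k) ((E j)^T *m Z j k *m tx_dir k)
  ((rx_dir j)^T *m base j k *m tx_dir k) ((rx_dir j)^T *m Z j k *m tx_dir k) => a b c e f g h abc.
have -> : c = - (a + b) by rewrite abc opprK.
by apply/matrixP => x y; rewrite !mxE; ring.
Qed.

End Curve.

Lemma entry_curve (C : numClosedFieldType) K (M N : 'I_K -> nat) d s l (Z : channels C M N) t x :
  entry (curve d s l Z t) x = entry (base C M N d s l) x + t * (entry Z x -
    t * (entry (residue0 d s l Z) x + t * entry (residue1 d s l Z) x)).
Proof. by rewrite /entry !mxE. Qed.

Lemma achievable_dense (C : numClosedFieldType) K (M N : 'I_K -> nat) d
    (h : {mpoly C[#|coord M N|]}) :
    (forall k, (0 < M k %/ d)%N) -> (forall k, (0 < N k %/ d)%N) ->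
    (forall I : {set 'I_K * 'I_K}, I \subset [set kj | kj.1 != kj.2] ->
      (#|I| <= \sum_(k | [exists j, (k, j) \in I]) (M k %/ d).-1 +
               \sum_(j | [exists k, (k, j) \in I]) (N j %/ d).-1)%N) ->
  h != 0 -> exists2 H : channels C M N, eval_channels h H != 0 & achievable H (fun=> d).
Proof.
move=> M_ge N_ge hallI h0.
pose cap (b : bool) k := ((if b then M k else N k) %/ d)%N.
have [||s [l [l_rng l_tx l_rx]]] := @slot_assignment K cap [set kj | kj.1 != kj.2].
- by case=> k; [apply: M_ge|apply: N_ge].
- exact: hallI.
have l_range k j : k != j -> (0 < l k j < if s k j then M k %/ d else N j %/ d)%N.
  by move=> kj; have := l_rng k j; rewrite inE kj /cap => /(_ isT); case: (s k j).
have l_inj_tx k j j' : k != j -> k != j' -> s k j -> s k j' -> l k j = l k j' -> j = j'.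
  by move=> kj kj'; apply: l_tx; rewrite inE.
have l_inj_rx j k k' : k != j -> k' != j -> ~~ s k j -> ~~ s k' j -> l k j = l k' j -> k = k'.
  by move=> kj kj'; apply: l_rx; rewrite inE.
pose B := base C M N d s l.
(* In the direction [z], [h] cannot vanish identically along the curve, whatever the higher-order
   terms. *)
have [z zP] := mpoly_curve_neq0 (fun i => entry B (enum_val i)) h0.
pose Z := of_entries (fun x : coord M N => z (enum_rank x)).
pose E j := slot_mx C (N j) d 0; pose F k := slot_mx C (M k) d 0.
pose X j := rx_dir d s l Z j; pose Y k := tx_dir d s l Z k.
pose Hc := curve d s l Z.
(* Entrywise the curve is [B + t w(t)] with [w(0) = z], the form that [zP] requires. *)
pose w i : {poly C} := (z i)%:P - 'X * ((entry (residue0 d s l Z) (enum_val i))%:P +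
                                        'X * (entry (residue1 d s l Z) (enum_val i))%:P).
have w0 i : (w i).[0] = z i by rewrite !hornerE /= ?mul0r ?subr0.
pose G := mmap (@polyC C) (fun i => (entry B (enum_val i))%:P + 'X * w i) h.
have GE t : G.[t] = eval_channels h (Hc t).
  rewrite horner_mmap; apply: meval_eq => i.
  have zE : z i = entry Z (enum_val i) by rewrite of_entriesE enum_valK.
  by rewrite entry_curve /w !hornerE zE.
(* The direct product along the curve, as a matrix of polynomials in [t]; its determinant is 1 at
   [t = 0]. *)
pose P k := (map_mx (@polyC C) (E k) + 'X *: map_mx (@polyC C) (X k))^T
  *m (map_mx (@polyC C) (B k k) + 'X *: map_mx (@polyC C) (Z k k))
  *m (map_mx (@polyC C) (F k) + 'X *: map_mx (@polyC C) (Y k)).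
have PE k t : (\det (P k)).[t] = \det ((E k + t *: X k)^T *m Hc t k k *m (F k + t *: Y k)).
  have lin m n (A A' : 'M[C]_(m, n)) :
      map_mx (horner_eval t) (map_mx (@polyC C) A + 'X *: map_mx (@polyC C) A') = A + t *: A'.
    by apply/matrixP => i j; rewrite !mxE /horner_eval !hornerE.
  rewrite -[LHS]/(horner_eval t _) -det_map_mx !map_mxM -map_trmx !lin.
  by rewrite /Hc /curve /residue0 /residue1 eqxx scaler0 addr0 scaler0 subr0.
have P0 k : \det (P k) != 0.
  have : (\det (P k)).[0] != 0.
    rewrite PE /Hc /curve !scale0r !addr0 /base eqxx mulmxA EE // mul1mx FF // det1.
    exact: oner_neq0.
  by apply: contraNneq => ->; rewrite horner0.
have /poly_nonroot[t] : G * \prod_k \det (P k) != 0.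
  by rewrite mulf_neq0 ?zP //; apply/prodf_neq0.
rewrite hornerM mulf_eq0 negb_or horner_prod => /andP[Gt /prodf_neq0 Pt].
exists (Hc t); first by rewrite -GE.
apply/achievable_bilinear; exists (fun k => F k + t *: Y k), (fun k => E k + t *: X k).
split=> [j k kj|k]; first exact: curve_aligned.
by apply/eqP; rewrite -/(row_free _) row_free_unit unitmxE unitfE -PE Pt.
Qed.

Theorem theorem2 (R : realType) (K : nat) (M N : 'I_K -> nat) (d : nat)
    (hK : (1 <= K)%N)
    (hM : forall k, (0 < M k)%N) (hN : forall k, (0 < N k)%N)
    (hd : (1 <= d)%N) (hdMN : forall k, (d <= minn (M k) (N k))%N)
    (hdvdM : forall k, (d %| M k)%N) (hdvdN : forall k, (d %| N k)%N) :
  generically (fun H : channels R[i] M N => achievable H (fun=> d)) <->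
  (forall I : {set 'I_K * 'I_K},
     I \subset [set kj : 'I_K * 'I_K | kj.1 != kj.2] ->
     (#|I| * d <= \sum_(k : 'I_K | [exists j, (k, j) \in I]) (M k - d)
                + \sum_(j : 'I_K | [exists k, (k, j) \in I]) (N j - d))%N).
Proof.
split=> [gen I Ioff|bound]; first exact: (generic_alignment_bound hd Ioff gen).
have M_ge k : (0 < M k %/ d)%N by rewrite divn_gt0 //; apply: leq_trans (hdMN k) (geq_minl _ _).
have N_ge k : (0 < N k %/ d)%N by rewrite divn_gt0 //; apply: leq_trans (hdMN k) (geq_minr _ _).
(* Divisibility by [d] splits the [n - d] remaining rows into whole free blocks, so the inequality
   can be divided by [d]. *)
have slots n : (d %| n)%N -> (n - d = (n %/ d).-1 * d)%N.
  by move=> dn; rewrite -subn1 mulnBl mul1n divnK.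
have [h h0 [ach|nach]] := achievable_generic R[i] M N d.
  exists (fun H => eval_channels h H != 0); split=> //.
    exists (fun p => p = h) => H; split=> [/negP/negPn/eqP hH p -> //|hH].
    by rewrite (hH h) // eqxx.
  have [y hy] := mpoly_nonroot h0.
  by exists (of_entries (fun x => y (enum_rank x))); rewrite eval_of_entries.
have hall (I : {set 'I_K * 'I_K}) : I \subset [set kj : 'I_K * 'I_K | kj.1 != kj.2] ->
    (#|I| <= \sum_(k | [exists j, (k, j) \in I]) (M k %/ d).-1 +
             \sum_(j | [exists k, (k, j) \in I]) (N j %/ d).-1)%N.
  move=> Ioff; rewrite -(leq_pmul2r hd) mulnDl !big_distrl /=; apply: (leq_trans (bound I Ioff)).
  by rewrite leq_add // leq_sum // => k _; rewrite slots.
by have [H hH /(nach H hH)] := achievable_dense M_ge N_ge hall h0.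
Qed.
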